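(* Let $n\geq 3$ and $\ell_1,\ldots,\ell_n>0$. There exists a polygon in $\mathbb{R}^{1,1}$ with $n$ spacelike sides of lengths $\ell_1,\ldots,\ell_n$ (in this cyclic order) that is inscribed in one branch of a hyperbola $\{x\in\mathbb{R}^{1,1} : \langle x,x\rangle_{1,1}=-R^2\}$ for some $R>0$ if and only if $$\ell_k>\sum_{\substack{i=1\\ i\neq k}}^{n}\ell_i\quad\text{for one }k\in\{1,\ldots,n\},$$ and in this case the polygon is unique (up to isometries of $\mathbb{R}^{1,1}$).
   Context: $\mathbb{R}^{1,1}$ is $\mathbb{R}^2$ with the scalar product $\langle x,y\rangle_{1,1}=x_1y_1-x_2y_2$. A vector $x$ is spacelike if $\langle x,x\rangle_{1,1}>0$, and its length is then $\sqrt{\langle x,x\rangle_{1,1}}$. Polygons are convex: a polygon inscribed in a branch of the hyperbola is given by $n$ distinct points $p_1,\ldots,p_n$ on that branch which, up to a cyclic shift of the labels, occur in monotone order along the branch; its sides are the straight line segments $p_kp_{k+1}$ (indices modulo $n$), the $k$-th side having length $\ell_k=\sqrt{\langle p_{k+1}-p_k,p_{k+1}-p_k\rangle_{1,1}}$. Two polygons are identified if an isometry of $\mathbb{R}^{1,1}$ maps one to the other, respecting the labelling of the sides. *)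

(* Defs.v *)
From mathcomp Require Import all_boot all_order all_algebra.
From mathcomp Require Import classical_sets reals.

Set Implicit Arguments.
Unset Strict Implicit.
Unset Printing Implicit Defensive.

Import Order.TTheory GRing.Theory Num.Theory.

Local Open Scope classical_set_scope.
Local Open Scope ring_scope.

Section MinkowskiPlane.
Variable R : realType.
Implicit Types x y : 'rV[R]_2.

Definition lorentz x y : R := x 0 0 * y 0 0 - x 0 1 * y 0 1.

Definition spacelike x : Prop := 0 < lorentz x x.

Definition lorentz_length x : R := Num.sqrt (lorentz x x).

(* On the hyperbola the second coordinate never vanishes (for r > 0); its sign
   separates the two branches: the upper one is [s = false], the lower one is
   [s = true]. *)
Definition hyperbola_branch (r : R) (s : bool) : set 'rV[R]_2 :=
  [set x | lorentz x x = - r ^+ 2 /\ 0 < (-1) ^+ s * x 0 1].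

Definition lorentz_isometry (f : 'rV[R]_2 -> 'rV[R]_2) : Prop :=
  bijective f /\
  forall x y, lorentz (f x - f y) (f x - f y) = lorentz (x - y) (x - y).

Section Polygons.
Variable n : nat.
Implicit Types p q : 'I_n -> 'rV[R]_2.

(* [ordS] is the cyclic successor on ['I_n]. *)
Definition side p (k : 'I_n) : 'rV[R]_2 := p (ordS k) - p k.

(* A branch is a graph over the first coordinate, so the order along it is the
   order of first coordinates.  The vertices are read in the cyclic order
   m, m+1, ..., m+n-1 (mod n); strictness makes them pairwise distinct. *)
Definition cyclically_monotone p : Prop :=
  exists m : 'I_n,
    let x1 (i : nat) := p (iter i (@ordS n) m) 0 0 in
    (forall i j : nat, (i < j < n)%N -> x1 i < x1 j) \/
    (forall i j : nat, (i < j < n)%N -> x1 j < x1 i).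

Definition inscribed_polygon p : Prop :=
  exists (r : R) (s : bool),
    [/\ 0 < r, forall k, hyperbola_branch r s (p k) & cyclically_monotone p].

Definition spacelike_sides_of_length (l : 'I_n -> R) p : Prop :=
  forall k, spacelike (side p k) /\ lorentz_length (side p k) = l k.

(* As n >= 3, an isometry carries the k-th side of p to the k-th side of q for
   all k exactly when it carries the k-th vertex of p to that of q. *)
Definition congruent p q : Prop :=
  exists f, lorentz_isometry f /\ forall k, f (p k) = q k.

End Polygons.
End MinkowskiPlane.

(* Main.v *)
Require Import Defs.
From mathcomp Require Import all_boot all_order all_algebra.
From mathcomp Require Import ring lra.
From mathcomp Require Import boolp classical_sets reals.
From mathcomp Require Import topology normedtype realfun.

Import Order.TTheory GRing.Theory Num.Theory.
Import numFieldNormedType.Exports.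

Local Open Scope ring_scope.

(** The points of a branch of the hyperbola of radius [r] are
    [r * (sinh t, cosh t)], and the chord between the parameters [t < t'] is
    spacelike of length [2 * r * sinh ((t' - t) / 2)].  Suppose that the
    vertices of a polygon are read off in increasing order.  Each of the first
    [n - 1] sides then spans one arc, and the last side spans the union of
    these arcs.  With [c = 1 / (2 * r)] the side lengths [a_0, ..., a_N],
    [N = n - 1], therefore satisfy the closing equation
      [asinh (c * a_0) + ... + asinh (c * a_(N-1)) = asinh (c * a_N)],
    and conversely every positive solution [c] of it gives a polygon.

    Three facts about this equation carry the proof.
    - It forces [a_0 + ... + a_(N-1) < a_N], because [sinh] is strictly
      superadditive on positive numbers ([closes_sum_lt]).  So the long side is
      one particular side, and it also determines the vertex at which the
      increasing order starts.
    - It has at most one solution: for [t > 1] the function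
      [x |-> asinh (t * sinh x)] is strictly subadditive on positive numbers,
      so enlarging [c] makes the left side too large ([closes_unique]).
    - It has a solution if [a_0 + ... + a_(N-1) < a_N]: the left side is the
      smaller one for small [c], where [asinh] is almost linear, and the larger
      one for large [c], because [N >= 2] and [sinh] of a sum of two terms then
      grows quadratically in [c]; continuity does the rest ([closes_exists]).

    Uniqueness up to isometry follows since reflections in the coordinate axes
    and a boost bring every inscribed polygon into a normal form that depends
    on [c] and the starting vertex only ([polygon_normal_form]).

    Everything is written multiplicatively, in terms of [u = exp x] in place of
    [x]: sums of arcs become products, and [sinh], [cosh] become the rational
    functions [hsin u], [hcos u], so that the identities between them are
    identities of rational functions. *)

(** * Hyperbolic functions in exponential coordinates *)

Section Hyperbolic.
Variable R : realType.
Implicit Types (u v w x y r t : R) (a : nat -> R) (N : nat).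

(** [sinh], [cosh] of [ln u], and the exponential of the inverse of [sinh]. *)
Definition hsin u : R := (u - u^-1) / 2.
Definition hcos u : R := (u + u^-1) / 2.
Definition earsinh x : R := x + Num.sqrt (1 + x ^+ 2).

Lemma hcos2 u : 0 < u -> hcos u ^+ 2 = 1 + hsin u ^+ 2.
Proof. by move=> u0; rewrite /hcos /hsin; field; rewrite gt_eqF. Qed.

Lemma hsin1 : hsin 1 = 0.
Proof. by rewrite /hsin invr1 subrr mul0r. Qed.

Lemma hsinM u v : 0 < u -> 0 < v ->
  hsin (u * v) = hsin u * hcos v + hcos u * hsin v.
Proof.
by move=> u0 v0; rewrite /hsin /hcos; field; rewrite !gt_eqF.
Qed.

Lemma hcos_gt0 u : 0 < u -> 0 < hcos u.
Proof. by move=> u0; rewrite divr_gt0 // addr_gt0 // invr_gt0. Qed.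

Lemma ltr_hsin u v : 0 < u -> 0 < v -> (hsin u < hsin v) = (u < v).
Proof.
move=> u0 v0; rewrite /hsin ltr_pM2r ?invr_gt0 //.
apply/idP/idP => [|uv]; last by rewrite ltrB // ltf_pV2.
by apply: contraLR; rewrite -!leNgt => vu; rewrite lerB // lef_pV2.
Qed.

Lemma hsin_gt0 u : 1 < u -> 0 < hsin u.
Proof. by move=> u1; rewrite -hsin1 ltr_hsin // (lt_trans _ u1). Qed.

(** Both [earsinh x > 0] and [earsinh (- x) > 0] come from this bound. *)
Lemma sqrt1D_gt x : `|x| < Num.sqrt (1 + x ^+ 2).
Proof. by rewrite -sqrtr_sqr ltr_sqrt ?ltrDr // ltr_pwDl // sqr_ge0. Qed.

Lemma earsinh_gt0 x : 0 < earsinh x.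
Proof.
have := sqrt1D_gt x; have := ler_norm (- x); rewrite normrN /earsinh; lra.
Qed.

Lemma earsinhN x : earsinh (- x) = (earsinh x)^-1.
Proof.
apply: (mulIf (lt0r_neq0 (earsinh_gt0 x))); rewrite mulVf ?gt_eqF ?earsinh_gt0 //.
rewrite /earsinh sqrrN.
have /sqr_sqrtr : 0 <= 1 + x ^+ 2 by rewrite addr_ge0 ?sqr_ge0.
set s := Num.sqrt _ => hs.
by rewrite [LHS](_ : _ = s ^+ 2 - x ^+ 2); [rewrite hs addrK | ring].
Qed.

Lemma hsin_earsinh x : hsin (earsinh x) = x.
Proof. by rewrite /hsin -earsinhN /earsinh sqrrN; field. Qed.

Lemma earsinh_hsin u : 0 < u -> earsinh (hsin u) = u.
Proof.
move=> u0; rewrite /earsinh -hcos2 // sqrtr_sqr gtr0_norm ?hcos_gt0 //.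
by rewrite /hsin /hcos; field; rewrite gt_eqF.
Qed.

Lemma ltr_earsinh x y : (earsinh x < earsinh y) = (x < y).
Proof. by rewrite -ltr_hsin ?earsinh_gt0 // !hsin_earsinh. Qed.

Lemma earsinh0 : earsinh 0 = 1.
Proof. by rewrite -hsin1 earsinh_hsin. Qed.

Lemma earsinh_gt1 x : 0 < x -> 1 < earsinh x.
Proof. by rewrite -earsinh0 ltr_earsinh. Qed.

Lemma hcos_gt1 u : 1 < u -> 1 < hcos u.
Proof.
move=> u1; have u0 : 0 < u by apply: lt_trans u1.
have c0 := hcos_gt0 _ u0; rewrite -ltr_sqr ?nnegrE ?(ltW c0) // expr1n.
by rewrite hcos2 // ltrDl exprn_gt0 // hsin_gt0.
Qed.

(** Addition theorem and [cosh > 1]: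
    [sinh (x + y) = sinh x * cosh y + cosh x * sinh y > sinh x + sinh y]. *)
Lemma hsin_superadditive u v : 1 < u -> 1 < v -> hsin u + hsin v < hsin (u * v).
Proof.
move=> u1 v1; rewrite hsinM ?(lt_trans ltr01) //.
by rewrite ltrD // ?ltr_pMr ?ltr_pMl ?hsin_gt0 ?hcos_gt1.
Qed.

(** What becomes of an arc when the chord keeps its length while the radius is
    divided by [t]: [exp x] goes to [exp (asinh (t * sinh x))]. *)
Definition stretch t u : R := earsinh (t * hsin u).

Lemma stretch_gt1 t u : 0 < t -> 1 < u -> 1 < stretch t u.
Proof. by move=> t0 u1; rewrite earsinh_gt1 // mulr_gt0 // hsin_gt0. Qed.

Lemma hcos_stretch t u : 1 < t -> 1 < u -> hcos u < hcos (stretch t u).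
Proof.
move=> t1 u1; have u0 : 0 < u by apply: lt_trans u1.
have e0 := earsinh_gt0 (t * hsin u); have s0 := hsin_gt0 _ u1.
rewrite -ltr_sqr ?nnegrE ?ltW ?hcos_gt0 // !hcos2 // hsin_earsinh ltrD2l.
have t0 : 0 < t by apply: lt_trans t1.
rewrite ltr_sqr ?nnegrE ?(ltW s0) ?ltr_pMl //.
by rewrite ltW // mulr_gt0.
Qed.

(** After applying [hsin], both sides expand by the addition theorem into the
    same products, with the factors [hcos] on the right taken at the stretched
    arguments, where they are larger. *)
Lemma stretch_submultiplicative t u v : 1 < t -> 1 < u -> 1 < v ->
  stretch t (u * v) < stretch t u * stretch t v.
Proof.
move=> t1 u1 v1; have [u0 v0] : 0 < u /\ 0 < v by rewrite !(lt_trans ltr01).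
rewrite -ltr_hsin ?mulr_gt0 ?earsinh_gt0 // hsin_earsinh !hsinM ?earsinh_gt0 //.
rewrite !hsin_earsinh mulrDr mulrA (mulrCA t (hcos u)).
have cu := hcos_stretch _ _ t1 u1; have cv := hcos_stretch _ _ t1 v1.
have su : 0 < t * hsin u by rewrite mulr_gt0 ?hsin_gt0 //; lra.
have sv : 0 < t * hsin v by rewrite mulr_gt0 ?hsin_gt0 //; lra.
by apply: ltrD; rewrite ?(ltr_pM2l su) ?(ltr_pM2r sv).
Qed.

(** * The closing equation *)

(** The exponential of [asinh (a 0) + ... + asinh (a (N - 1))].  A recursive
    definition makes induction and continuity immediate. *)
Fixpoint turn a N : R := if N is j.+1 then turn a j * earsinh (a j) else 1.

Lemma eq_turn a b N : a =1 b -> turn a N = turn b N.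
Proof. by move=> ab; elim: N => //= N ->; rewrite ab. Qed.

Lemma turn_gt0 a N : 0 < turn a N.
Proof. by elim: N => //= N IH; rewrite mulr_gt0 // earsinh_gt0. Qed.

Lemma turn_lt a i j : (forall k, 0 < a k) -> (i < j)%N -> turn a i < turn a j.
Proof.
move=> a0; elim: j => //= j IH; rewrite ltnS leq_eqVlt.
have st : turn a j < turn a j * earsinh (a j).
  by rewrite ltr_pMr ?turn_gt0 ?earsinh_gt1.
by case/orP=> [/eqP-> //|/IH /lt_trans]; apply.
Qed.

Lemma turn_gt1 a N : (forall k, 0 < a k) -> (0 < N)%N -> 1 < turn a N.
Proof. by move=> a0 /(turn_lt _ _ _ a0). Qed.

Lemma sum_lt_hsin_turn a N : (forall k, 0 < a k) -> (2 <= N)%N ->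
  \sum_(j < N) a j < hsin (turn a N).
Proof.
move=> a0; case: N => [|[|N]] // _; elim: N => [|N IH].
  rewrite !big_ord_recr big_ord0 /= add0r mul1r.
  by rewrite -{1}[a 0]hsin_earsinh -{1}[a 1]hsin_earsinh
    hsin_superadditive ?earsinh_gt1.
rewrite big_ord_recr [turn _ _]/=.
apply: lt_trans (hsin_superadditive _ _ (turn_gt1 _ N.+2 a0 isT) (earsinh_gt1 _ (a0 _))).
by rewrite hsin_earsinh ltrD2r.
Qed.

Lemma stretch_turn a N t : (forall k, 0 < a k) -> 1 < t -> (2 <= N)%N ->
  stretch t (turn a N) < turn (fun k => t * a k) N.
Proof.
move=> a0 t1; have st x : stretch t (earsinh x) = earsinh (t * x).
  by rewrite /stretch hsin_earsinh.
case: N => [|[|N]] // _; elim: N => [|N IH].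
  rewrite /= !mul1r -!st.
  by rewrite stretch_submultiplicative ?earsinh_gt1.
rewrite ![turn _ N.+3]/= -/(turn _ N.+2).
apply: lt_trans
  (stretch_submultiplicative _ _ _ t1 (turn_gt1 _ N.+2 a0 isT) (earsinh_gt1 _ (a0 _))) _.
by rewrite st ltr_pM2r ?earsinh_gt0.
Qed.

(** The condition for chords with half-lengths [a 0, ..., a (N - 1)] placed one
    after the other along the unit hyperbola to be closed up by a chord of
    half-length [a N]. *)
Definition closes a N := turn a N = earsinh (a N).

Lemma closes_sum_lt a N : (forall k, 0 < a k) -> (2 <= N)%N ->
  closes a N -> \sum_(j < N) a j < a N.
Proof.
by move=> a0 N2 ca; rewrite -[ltRHS]hsin_earsinh -ca sum_lt_hsin_turn.
Qed.

(** Stretching all arcs makes the first [N] of them together exceed the last. *)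
Lemma closes_stretch a N t : (forall k, 0 < a k) -> (2 <= N)%N -> 1 < t ->
  closes a N -> ~ closes (fun k => t * a k) N.
Proof.
move=> a0 N2 t1 ca cta; have := stretch_turn a N t a0 t1 N2.
by rewrite cta /stretch ca hsin_earsinh ltxx.
Qed.

Lemma closes_unique a N x y : (forall k, 0 < a k) -> (2 <= N)%N ->
  0 < x -> 0 < y ->
  closes (fun k => x * a k) N -> closes (fun k => y * a k) N -> x = y.
Proof.
move=> a0 N2; wlog xy : x y / x <= y => [H|] x0 y0 cx cy.
  by case/orP: (le_total x y) => h; [exact: H|apply/esym; exact: H].
apply/eqP; case: ltgtP xy => // xy _.
have := closes_stretch (fun k => x * a k) N (y / x).
case=> //; first by move=> k; rewrite mulr_gt0.
  by rewrite ltr_pdivlMr ?mul1r.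
have E : (fun k => y / x * (x * a k)) =1 (fun k => y * a k).
  by move=> k; rewrite mulrA divfK ?gt_eqF.
by rewrite /closes (eq_turn _ _ _ E) E.
Qed.

(** [earsinh x] is the inverse of [earsinh (- x) = sqrt (1 + x ^ 2) - x]. *)
Lemma earsinh_le x : x < 1 -> earsinh x <= (1 - x)^-1.
Proof.
move=> x1; rewrite -[earsinh x]invrK lef_pV2 ?posrE ?invr_gt0 ?earsinh_gt0 ?subr_gt0 //.
rewrite -earsinhN /earsinh sqrrN [leRHS]addrC lerD2r.
by rewrite -[leLHS]sqrtr1 ler_wsqrtr // lerDl sqr_ge0.
Qed.

(** The product of the bounds [earsinh_le] is at most this one, since
    [(1 - s) * (1 - y) >= 1 - (s + y)]. *)
Lemma turn_le a N : (forall k, 0 < a k) -> \sum_(j < N) a j < 1 ->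
  turn a N <= (1 - \sum_(j < N) a j)^-1.
Proof.
move=> a0; elim: N => [|N IH]; first by rewrite big_ord0 subr0 invr1.
rewrite big_ord_recr /=; set s := \sum_(j < N) a j in IH *.
move=> sa1; have s1 : s < 1 by apply: lt_trans sa1; rewrite ltrDl.
have s0 : 0 <= s by apply: sumr_ge0 => j _; exact: ltW.
have aN1 : a N < 1 by apply: le_lt_trans sa1; rewrite lerDr.
apply: (@le_trans _ _ ((1 - s)^-1 * (1 - a N)^-1)).
  by rewrite ler_pM ?IH ?earsinh_le ?ltW ?turn_gt0 ?earsinh_gt0.
rewrite -invfM lef_pV2 ?posrE ?mulr_gt0 ?subr_gt0 //.
have := a0 N; nra.
Qed.

(** With [s] the sum of the [a j], [turn_le] bounds the left side by
    [hsin (1 - x * s)^-1 = x * s * (1 - x * s / 2) / (1 - x * s)], whose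
    quotient by [x] tends to [s < L] as [x] tends to [0]. *)
Lemma hsin_turn_small a N (L : R) : (forall k, 0 < a k) -> (2 <= N)%N ->
  \sum_(j < N) a j < L ->
  exists2 x, 0 < x & hsin (turn (fun k => x * a k) N) < x * L.
Proof.
move=> a0 N2; set s := \sum_(j < N) a j => sL.
have s0 : 0 < s.
  case: N N2 @s sL => // N _ s sL; rewrite /s big_ord_recr /= ltr_wpDl //.
  by apply: sumr_ge0 => j _; exact: ltW.
have L0 : 0 < L by apply: lt_trans sL.
(* any [x] with [x * s * (L - s / 2) < L - s] will do *)
pose x := (L - s) / (L * s).
have x0 : 0 < x by rewrite divr_gt0 ?subr_gt0 ?mulr_gt0.
have xs : x * s = (L - s) / L by rewrite /x; field; rewrite !gt_eqF.
have xs1 : x * s < 1 by rewrite xs ltr_pdivrMr // mul1r gtrBl.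
exists x => //.
have xsE : \sum_(j < N) x * a j = x * s by rewrite -mulr_sumr.
have xa0 k : 0 < x * a k by rewrite mulr_gt0.
have := turn_le (fun k => x * a k) N xa0; rewrite xsE => /(_ xs1) tle.
apply: (@le_lt_trans _ _ (hsin (1 - x * s)^-1)).
  by rewrite leNgt ltr_hsin ?turn_gt0 ?invr_gt0 ?subr_gt0 // -leNgt.
have -> : 1 - x * s = s / L by rewrite xs; field; rewrite gt_eqF.
have -> : x * L = (L - s) / s by rewrite /x; field; rewrite !gt_eqF.
rewrite -subr_gt0 /hsin.
rewrite [ltRHS](_ : _ = (L - s) ^+ 2 / (2 * L * s)); last by field; rewrite !gt_eqF.
by rewrite divr_gt0 ?mulr_gt0 ?exprn_gt0 // subr_gt0.
Qed.

(** Two factors already suffice: the [hsin] of their product is at least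
    [2 * (y * a 0) * (y * a 1)], which is quadratic in [y]. *)
Lemma hsin_turn_large a N (L : R) : (forall k, 0 < a k) -> (2 <= N)%N -> 0 < L ->
  exists2 x, 0 < x & forall y, x <= y -> y * L <= hsin (turn (fun k => y * a k) N).
Proof.
move=> a0 N2 L0; pose x := L / (2 * a 0%N * a 1%N).
have x0 : 0 < x by rewrite divr_gt0 ?mulr_gt0.
exists x => // y xy; have y0 : 0 < y by apply: lt_le_trans xy.
have ya0 k : 0 < y * a k by rewrite mulr_gt0.
have hc z : 0 < z -> z <= hcos (earsinh z).
  move=> z0; have h0 := hcos_gt0 _ (earsinh_gt0 z).
  by rewrite -ler_sqr ?nnegrE ?(ltW z0) ?(ltW h0) // hcos2 ?earsinh_gt0 // hsin_earsinh lerDr.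
apply: (@le_trans _ _ (hsin (turn (fun k => y * a k) 2))); last first.
  rewrite leNgt ltr_hsin ?turn_gt0 // -leNgt.
  by move: N2; rewrite leq_eqVlt => /orP[/eqP<- //|/(turn_lt _ _ _ ya0)/ltW].
rewrite /= mul1r hsinM ?earsinh_gt0 // !hsin_earsinh.
have h0 := hc _ (ya0 0%N); have h1 := hc _ (ya0 1%N).
apply: (@le_trans _ _ (2 * (y * a 0%N) * (y * a 1%N))); last first.
  have := ya0 0%N; have := ya0 1%N; nra.
have : L <= y * (2 * a 0%N * a 1%N) by rewrite -ler_pdivrMr ?mulr_gt0.
move=> /(ler_wpM2l (ltW y0)) /le_trans; apply.
by rewrite le_eqVlt; apply/orP; left; apply/eqP; ring.
Qed.

Lemma earsinh_continuous : continuous earsinh.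
Proof.
move=> x; apply: cvgD; first exact: cvg_id.
apply: (@continuous_comp _ _ _ (fun x => 1 + x ^+ 2)).
  by apply: cvgD; [exact: cvg_cst|exact: exprn_continuous].
exact: sqrt_continuous.
Qed.

Lemma turn_continuous a N : continuous (fun x => turn (fun k => x * a k) N).
Proof.
elim: N => [|N IH] x /=; first exact: cvg_cst.
apply: cvgM; first exact: IH.
apply: (@continuous_comp _ _ _ (fun x => x * a N)); last exact: earsinh_continuous.
exact: mulrr_continuous.
Qed.

Lemma closes_exists a N : (forall k, 0 < a k) -> (2 <= N)%N ->
  \sum_(j < N) a j < a N -> exists2 x, 0 < x & closes (fun k => x * a k) N.
Proof.
move=> a0 N2 sa.
have [x x0 hx] := hsin_turn_small a N _ a0 N2 sa.
have [y y0 hy] := hsin_turn_large a N _ a0 N2 (a0 N).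
have xy : x <= Num.max x y by rewrite le_max lexx.
pose g z := turn (fun k => z * a k) N - earsinh (z * a N).
have gc : continuous g.
  move=> z; apply: cvgB; first exact: turn_continuous.
  apply: (@continuous_comp _ _ _ (fun x => x * a N)); last exact: earsinh_continuous.
  exact: mulrr_continuous.
have g1 : g x <= 0.
  by rewrite subr_le0 ltW // -ltr_hsin ?turn_gt0 ?earsinh_gt0 // hsin_earsinh.
have g2 : 0 <= g (Num.max x y).
  rewrite subr_ge0 leNgt -ltr_hsin ?turn_gt0 ?earsinh_gt0 // hsin_earsinh -leNgt.
  by rewrite hy // le_max lexx orbT.
have [|z] := @IVT R g x (Num.max x y) 0 xy (continuous_subspaceT gc).
  by rewrite ge_min le_max g1 g2 orbT.
rewrite in_itv /= => /andP[xz _] /eqP; rewrite subr_eq0 => /eqP gz.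
by exists z => //; apply: lt_le_trans xz.
Qed.

End Hyperbolic.

Arguments hsin {R}.
Arguments hcos {R}.
Arguments earsinh {R}.
Arguments turn {R}.
Arguments closes {R}.

(** * The branch of the hyperbola and isometries of the plane *)

Section Plane.
Variable R : realType.
Implicit Types (u v w r : R) (x y : 'rV[R]_2).

Definition vec2 (a b : R) : 'rV[R]_2 := \row_j (if j == 0 then a else b).

Lemma vec2E x : x = vec2 (x 0 0) (x 0 1).
Proof.
apply/rowP => j; rewrite mxE; case: eqP => [->//|/eqP j0].
by congr (x 0 _); case: j j0 => [[|[|]]] // ? ?; apply: val_inj.
Qed.

Lemma lorentz_vec2 a b : lorentz (vec2 a b) (vec2 a b) = a ^+ 2 - b ^+ 2.
Proof. by rewrite /lorentz !mxE /= -!expr2. Qed.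

Lemma vec2B a b c d : vec2 a b - vec2 c d = vec2 (a - c) (b - d).
Proof. by apply/rowP => j; rewrite !mxE; case: ifP. Qed.

Definition hpoint r u : 'rV[R]_2 := vec2 (r * hsin (u ^+ 2)) (r * hcos (u ^+ 2)).

(** In additive terms the parameter [u] is [exp (t / 2)] for the point
    [r * (sinh t, cosh t)]: the half makes the chord length rational in [u]
    and [v]. *)
Lemma hpoint_chord r u v : 0 < u -> 0 < v ->
  lorentz (hpoint r u - hpoint r v) (hpoint r u - hpoint r v)
  = (2 * r * hsin (u / v)) ^+ 2.
Proof.
move=> u0 v0; rewrite vec2B lorentz_vec2 /hsin /hcos.
by field; rewrite !gt_eqF.
Qed.

Lemma hpoint_lt r u v : 0 < r -> 0 < u -> 0 < v ->
  (hpoint r u 0 0 < hpoint r v 0 0) = (u < v).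
Proof.
move=> r0 u0 v0; rewrite !mxE /= ltr_pM2l // ltr_hsin ?exprn_gt0 //.
by rewrite ltr_sqr ?nnegrE ?ltW.
Qed.

Lemma hpoint_branch r u : 0 < r -> 0 < u -> hyperbola_branch r false (hpoint r u).
Proof.
move=> r0 u0; have u2 : 0 < u ^+ 2 by rewrite exprn_gt0.
split; last by rewrite mxE /= mul1r mulr_gt0 // hcos_gt0.
by rewrite lorentz_vec2; ring: (hcos2 _ _ u2).
Qed.

(** The parameter is found from the lightlike coordinates of [x]: their product
    is [r ^ 2], so the positive number [(x_1 + x_0) / r] and its inverse
    [(x_1 - x_0) / r] are [u ^ 2] and [u ^- 2]. *)
Lemma branch_hpoint r x : 0 < r -> hyperbola_branch r false x ->
  exists2 u, 0 < u & x = hpoint r u.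
Proof.
move=> r0 [xx]; rewrite mul1r => x1.
rewrite [x]vec2E; set a := x 0 0 in xx *; set b := x 0 1 in xx x1 *.
have ab : (b + a) * (b - a) = r ^+ 2.
  by move: xx; rewrite /lorentz -/a -/b => xx; rewrite -[RHS]opprK -xx; ring.
have r2 : 0 < (b + a) * (b - a) by rewrite ab exprn_gt0.
have s0 : 0 < b + a.
  rewrite ltNge; apply/negP => s0; have d0 : 0 <= b - a by lra.
  by have := mulr_le0_ge0 s0 d0; rewrite leNgt r2.
have w0 : 0 < (b + a) / r by rewrite divr_gt0.
exists (Num.sqrt ((b + a) / r)); first by rewrite sqrtr_gt0.
have wV : ((b + a) / r)^-1 = (b - a) / r.
  apply: (mulIf (lt0r_neq0 w0)); rewrite mulVf ?lt0r_neq0 //.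
  by rewrite mulf_div (mulrC (b - a)) ab expr2 divff // mulf_neq0 ?gt_eqF.
rewrite /hpoint sqr_sqrtr ?ltW // /hsin /hcos wV.
by congr vec2; field; rewrite gt_eqF.
Qed.

Definition reflection (s t : bool) x := vec2 ((-1) ^+ s * x 0 0) ((-1) ^+ t * x 0 1).

Lemma reflection_isometry s t : lorentz_isometry (reflection s t).
Proof.
have K : involutive (reflection s t).
  by move=> x; rewrite [RHS]vec2E /reflection !mxE /= !signrMK.
split=> [|x y]; first by exists (reflection s t).
rewrite /reflection vec2B -!mulrBr lorentz_vec2 !exprMn !sqrr_sign !mul1r.
by rewrite /lorentz !mxE !expr2.
Qed.

Definition boost w x :=
  vec2 (hcos (w ^+ 2) * x 0 0 + hsin (w ^+ 2) * x 0 1)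
       (hsin (w ^+ 2) * x 0 0 + hcos (w ^+ 2) * x 0 1).

Lemma boost_isometry w : 0 < w -> lorentz_isometry (boost w).
Proof.
move=> w0; have wn0 : w != 0 by rewrite gt_eqF.
split=> [|x y].
  exists (boost w^-1) => x; rewrite [RHS]vec2E /boost !mxE /= /hcos /hsin;
  by congr vec2; field.
by rewrite /boost vec2B lorentz_vec2 /lorentz !mxE /hcos /hsin; field.
Qed.

Lemma boost_hpoint w r u : 0 < w -> 0 < u -> boost w (hpoint r u) = hpoint r (w * u).
Proof.
move=> w0 u0; have [wn0 un0] : w != 0 /\ u != 0 by rewrite !gt_eqF.
by rewrite /boost /hpoint !mxE /= /hcos /hsin; congr vec2; field; rewrite wn0 un0.
Qed.

Lemma isometry_comp (f g : 'rV[R]_2 -> 'rV[R]_2) :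
  lorentz_isometry f -> lorentz_isometry g -> lorentz_isometry (f \o g).
Proof.
move=> [bf hf] [bg hg]; split; first exact: bij_comp.
by move=> x y; rewrite /= hf hg.
Qed.

(** Polygons with a common normal form are congruent. *)
Lemma congruent_common n (p q : 'I_n -> 'rV[R]_2) (f g : 'rV[R]_2 -> 'rV[R]_2) :
  lorentz_isometry f -> lorentz_isometry g -> (forall k, f (p k) = g (q k)) ->
  congruent p q.
Proof.
move=> fi [[h gK hK] gi] fg; exists (h \o f); split; last by move=> k; rewrite /= fg gK.
apply: isometry_comp => //; split; first by exists g.
by move=> x y; rewrite -gi !hK.
Qed.

End Plane.

Arguments hpoint {R}.
Arguments reflection {R}.
Arguments boost {R}.

(** * Cyclic indices *)

Section CyclicIndices.
Variable N : nat.
Implicit Types k m : 'I_N.+1.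

(** Translates iterated successors into the additive group of ['I_N.+1], where
    they can be inverted by subtraction. *)
Lemma iter_ordS m i : iter i (@ordS N.+1) m = m + inZp i.
Proof.
elim: i => [|i IH] /=; apply: val_inj => /=; first by rewrite mod0n addn0 modn_small.
by rewrite IH /= !modnDmr addnS -(addn1 (_ %% _)) modnDml addn1.
Qed.

Lemma iter_ordS_full m : iter N.+1 (@ordS N.+1) m = m.
Proof. by rewrite iter_ordS; apply: val_inj; rewrite /= modnn addn0 modn_small. Qed.

Lemma iter_ordS_sub m k : iter (k - m)%R (@ordS N.+1) m = k.
Proof. by rewrite iter_ordS valZpK subrKC. Qed.

Lemma sub_iter_ordS m i : (i <= N)%N -> (iter i (@ordS N.+1) m - m : 'I_N.+1) = i :> nat.
Proof. by move=> iN; rewrite iter_ordS addrAC subrr add0r /= modn_small. Qed.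

Lemma sum_iter_ordS (V : zmodType) (F : 'I_N.+1 -> V) m :
  \sum_(i | i != iter N (@ordS N.+1) m) F i
  = \sum_(j < N) F (iter j (@ordS N.+1) m).
Proof.
set k := iter N _ m; apply: (@addrI _ (F k)).
transitivity (\sum_i F i); first by rewrite [RHS](bigD1 k).
rewrite (reindex (fun i : 'I_N.+1 => iter i (@ordS N.+1) m)).
  by rewrite big_ord_recr addrC.
exists (fun j => j - m) => i _; last exact: iter_ordS_sub.
by apply/val_inj/sub_iter_ordS; rewrite -ltnS.
Qed.

End CyclicIndices.

(** * Normal form of inscribed polygons *)

Section NormalForm.
Variables (R : realType) (N : nat) (l : 'I_N.+1 -> R).
Hypothesis l0 : forall k, 0 < l k.
Hypothesis N2 : (2 <= N)%N.
Implicit Types (p : 'I_N.+1 -> 'rV[R]_2) (m k : 'I_N.+1) (c : R).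

(** With [c = 1 / (2 * r)], the half-length of the [i]-th side counted from [m],
    relative to the radius [r]. *)
Definition half_chord c m (i : nat) : R := c * l (iter i (@ordS N.+1) m).

Lemma half_chord_gt0 c m i : 0 < c -> 0 < half_chord c m i.
Proof. by move=> c0; rewrite mulr_gt0. Qed.

(** The polygon whose vertex [m] is the apex [(0, r)] of the upper branch and
    whose vertices go to the right from there. *)
Definition normal_vertex c m (i : nat) : 'rV[R]_2 :=
  hpoint (2 * c)^-1 (turn (half_chord c m) i).

Lemma normal_chord c m i j : 0 < c ->
  lorentz (normal_vertex c m i - normal_vertex c m j)
    (normal_vertex c m i - normal_vertex c m j)
  = (hsin (turn (half_chord c m) i / turn (half_chord c m) j) / c) ^+ 2.
Proof.
move=> c0; rewrite hpoint_chord ?turn_gt0 //; congr (_ ^+ 2).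
by field; rewrite gt_eqF.
Qed.

Lemma normal_polygon c m : 0 < c -> closes (half_chord c m) N ->
  exists p, inscribed_polygon p /\ spacelike_sides_of_length l p.
Proof.
move=> c0 cl; have a0 i := half_chord_gt0 c m i c0.
pose p k := normal_vertex c m (k - m)%R.
have pE i : (i <= N)%N -> p (iter i (@ordS N.+1) m) = normal_vertex c m i.
  by move=> iN; rewrite /p sub_iter_ordS.
have r0 : 0 < (2 * c)^-1 by rewrite invr_gt0 mulr_gt0.
exists p; split.
  exists (2 * c)^-1, false; split=> // [k|].
    by apply: hpoint_branch; rewrite ?turn_gt0.
  exists m; left=> i j /andP[ij]; rewrite ltnS => jN.
  rewrite !pE ?(leq_trans (ltnW ij)) // hpoint_lt ?turn_gt0 //.
  exact: turn_lt.
move=> k; rewrite /spacelike /lorentz_length.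
suff -> : lorentz (side p k) (side p k) = l k ^+ 2.
  by rewrite exprn_gt0 // sqrtr_sqr gtr0_norm.
rewrite -(iter_ordS_sub N m k); set i := nat_of_ord (k - m)%R.
have : (i <= N)%N by rewrite -ltnS ltn_ord.
rewrite /side -iterS leq_eqVlt => /orP[/eqP->|iN].
  (* the last side runs backwards, from the vertex [N] to the vertex [0] *)
  rewrite iter_ordS_full -{1 3}[m]/(iter 0 (@ordS N.+1) m) !pE // normal_chord //.
  rewrite cl /= mul1r /hsin invrK -opprB mulNr -[_ / 2]/(hsin _) hsin_earsinh.
  by rewrite /half_chord mulNr sqrrN mulrC mulKf ?gt_eqF.
rewrite !pE // ?(ltnW iN) // normal_chord //= [X in hsin X]mulrC mulKf ?gt_eqF ?turn_gt0 //.
by rewrite hsin_earsinh [X in X ^+ 2]mulrC mulKf ?gt_eqF.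
Qed.

(** One reflection moves the polygon to the upper branch, another one makes the
    first coordinates increase, and a boost, which multiplies all parameters
    by a constant, takes the first vertex to the parameter [1]. *)
Lemma inscribed_hpoints p : inscribed_polygon p ->
  exists f m r (v : nat -> R),
    [/\ lorentz_isometry f, 0 < r, v 0%N = 1
      & forall i, (i <= N)%N -> f (p (iter i (@ordS N.+1) m)) = hpoint r (v i)]
    /\ [/\ (forall i, (i <= N)%N -> 0 < v i)
         & forall i j, (i < j <= N)%N -> v i < v j].
Proof.
move=> [r [s [r0 pb [m mono]]]].
have [t incr] : exists t : bool, forall i j, (i < j <= N)%N ->
    (-1) ^+ t * p (iter i (@ordS N.+1) m) 0 0
    < (-1) ^+ t * p (iter j (@ordS N.+1) m) 0 0.
  case: mono => mono; [exists false|exists true] => i j ij.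
    by rewrite !mul1r mono.
  by rewrite !mulN1r ltrN2 mono.
pose g := @reflection R t s.
have gb k : hyperbola_branch r false (g (p k)).
  have [e b] := pb k; split; last by rewrite mxE /= mul1r.
  by rewrite lorentz_vec2 !exprMn !sqrr_sign !mul1r -e /lorentz !expr2.
have /choice[u uP] : forall k, exists u, 0 < u /\ g (p k) = hpoint r u.
  by move=> k; have [u] := branch_hpoint _ r _ r0 (gb k); exists u.
pose V i := u (iter i (@ordS N.+1) m).
have V0 i : 0 < V i by have [] := uP (iter i (@ordS N.+1) m).
have VE i : g (p (iter i (@ordS N.+1) m)) = hpoint r (V i).
  by have [] := uP (iter i (@ordS N.+1) m).
have W0 : 0 < (V 0%N)^-1 by rewrite invr_gt0.
exists (boost (V 0%N)^-1 \o g), m, r, (fun i => (V 0%N)^-1 * V i).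
split; split=> //.
- by apply: isometry_comp; [exact: boost_isometry|exact: reflection_isometry].
- by rewrite mulVf // gt_eqF.
- by move=> i _; rewrite /= VE boost_hpoint.
- by move=> i _; rewrite mulr_gt0.
- by move=> i j ij; rewrite ltr_pM2l // -(hpoint_lt _ r) // -!VE !mxE incr.
Qed.

(** The lengths of the sides [0, ..., N - 1] determine the quotients of
    consecutive parameters and hence all of them; the length of the side [N] is
    then the closing equation. *)
Lemma polygon_normal_form p : inscribed_polygon p -> spacelike_sides_of_length l p ->
  exists f c m, [/\ lorentz_isometry f, 0 < c, closes (half_chord c m) N
    & forall i, (i <= N)%N -> f (p (iter i (@ordS N.+1) m)) = normal_vertex c m i].
Proof.
move=> /inscribed_hpoints[f [m [r [v [[fi r0 v1 fE] [v0 vlt]]]]]] len.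
pose c := (2 * r)^-1; have c0 : 0 < c by rewrite invr_gt0 mulr_gt0.
have rE : r = (2 * c)^-1 by rewrite /c; field; rewrite gt_eqF.
(* serves both for the short sides, from [i] to [i + 1], and for the long side
   that joins [0] and [N] *)
have chord i j k : (i < j <= N)%N ->
    lorentz (side p k) (side p k) = lorentz (hpoint r (v j) - hpoint r (v i))
                                      (hpoint r (v j) - hpoint r (v i)) ->
    v j = v i * earsinh (c * l k).
  move=> ij e; have [iN jN] : (i <= N)%N /\ (j <= N)%N.
    by case/andP: ij => /ltnW ij jN; rewrite (leq_trans ij jN).
  have q1 : 1 < v j / v i by rewrite ltr_pdivlMr ?v0 // mul1r vlt.
  have <- : hsin (v j / v i) = c * l k.
    have [_ <-] := len k; rewrite /lorentz_length e hpoint_chord ?v0 //.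
    have r2 : 0 < 2 * r by rewrite mulr_gt0.
    by rewrite sqrtr_sqr gtr0_norm ?(mulr_gt0 r2) ?hsin_gt0 // mulKf ?gt_eqF.
  by rewrite earsinh_hsin ?(lt_trans ltr01) // mulrC divfK // gt_eqF ?v0.
have vturn i : (i <= N)%N -> v i = turn (half_chord c m) i.
  elim: i => [//|i IH] iN; rewrite /= -IH ?(ltnW iN) //.
  apply: chord; first by rewrite leqnn.
  by rewrite -!fE ?(ltnW iN) // (proj2 fi).
exists f, c, m; split=> // [|i iN]; last by rewrite fE // vturn // /normal_vertex -rE.
rewrite /closes -vturn // -[RHS]mul1r -v1; apply: chord; first by rewrite leqnn ltnW.
rewrite -!fE // (proj2 fi) /side -iterS iter_ordS_full.
by rewrite /lorentz !mxE; ring.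
Qed.

Lemma closes_long_side c m : 0 < c -> closes (half_chord c m) N ->
  \sum_(i | i != iter N (@ordS N.+1) m) l i < l (iter N (@ordS N.+1) m).
Proof.
move=> c0 cl; rewrite sum_iter_ordS -(ltr_pM2l c0) mulr_sumr.
by apply: (closes_sum_lt _ (half_chord c m)) => // i; exact: half_chord_gt0.
Qed.

Lemma long_side_closes k : \sum_(i | i != k) l i < l k ->
  exists c m, 0 < c /\ closes (half_chord c m) N.
Proof.
have <- : iter N (@ordS N.+1) (ordS k) = k by rewrite -iterSr iter_ordS_full.
rewrite sum_iter_ordS => /(closes_exists _ (fun i => l (iter i (@ordS N.+1) (ordS k)))).
by case=> // c c0 cl; exists c, (ordS k).
Qed.

Lemma long_side_unique k k' :
  \sum_(i | i != k) l i < l k -> \sum_(i | i != k') l i < l k' -> k = k'.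
Proof.
have le j j' : j != j' -> l j <= \sum_(i | i != j') l i.
  by move=> jj; rewrite (bigD1 j) //= lerDl sumr_ge0 // => i _; exact: ltW.
move=> hk hk'; apply/eqP/negPn/negP => kk.
have := lt_trans (le_lt_trans (le _ _ kk) hk') (le_lt_trans (le k' k _) hk).
by rewrite eq_sym ltxx => /(_ kk).
Qed.

(** The starting vertex [m] is the one after the long side. *)
Lemma closes_normal_unique c c' m m' : 0 < c -> 0 < c' ->
  closes (half_chord c m) N -> closes (half_chord c' m') N -> c = c' /\ m = m'.
Proof.
move=> c0 c0' cl cl'.
have mm : m = m'.
  rewrite -(iter_ordS_full N m) -(iter_ordS_full N m') !iterS.
  congr ordS; apply: long_side_unique.
    exact: closes_long_side c0 cl.
  exact: closes_long_side c0' cl'.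
split=> //; move: cl'; rewrite -mm => cl'.
by apply: (closes_unique _ (fun i => l (iter i (@ordS N.+1) m)) N).
Qed.

End NormalForm.

Theorem theorem4 (R : realType) (n : nat) (l : 'I_n -> R)
    (hn : (3 <= n)%N) (hl : forall k : 'I_n, 0 < l k) :
  ((exists p : 'I_n -> 'rV[R]_2,
      inscribed_polygon p /\ spacelike_sides_of_length l p)
   <-> (exists k : 'I_n, l k > \sum_(i < n | i != k) l i))
  /\
  (forall p q : 'I_n -> 'rV[R]_2,
      inscribed_polygon p -> spacelike_sides_of_length l p ->
      inscribed_polygon q -> spacelike_sides_of_length l q ->
      congruent p q).
Proof.
case: n l hn hl => // N l N2 l0; split; first split.
- move=> [p [ip lp]]; have [f [c [m [_ c0 cl _]]]] := polygon_normal_form _ _ _ N2 p ip lp.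
  by exists (iter N (@ordS N.+1) m); apply: closes_long_side cl.
- move=> [k /long_side_closes[]// c [m [c0 cl]]]; exact: normal_polygon cl.
move=> p q ip lp iq lq.
have [f [c [m [fi c0 cl fE]]]] := polygon_normal_form _ _ _ N2 p ip lp.
have [g [c' [m' [gi c0' cl' gE]]]] := polygon_normal_form _ _ _ N2 q iq lq.
have [cc mm] := closes_normal_unique _ _ _ l0 N2 _ _ _ _ c0 c0' cl cl'; subst c' m'.
apply: (congruent_common _ _ _ _ _ _ fi gi) => k.
have iN : ((k - m)%R <= N)%N by rewrite -ltnS ltn_ord.
by rewrite -(iter_ordS_sub N m k) fE // gE.
Qed.
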